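(* The number of polygonizations that a double chain $D$ of $N=2n$ points admits is at most $O(5.610718614^N)$.
   Context: A polygonization of a finite point set in the plane is a non-crossing Hamiltonian cycle on it, i.e. a simple polygon whose vertex set is exactly the point set, with straight-line edges no two of which cross. A double chain of $N=2n$ points is a set of points in the plane such that: $n$ of the points lie on an upper convex chain $U$ and the other $n$ lie on a lower convex chain $L$, the two chains having opposite concavity; for every pair of points of $U$, the line through them leaves all points of $L$ below it; and for every pair of points of $L$, the line through them leaves all points of $U$ above it. *)

(* Defs.v *)
From HB Require Import structures.
From mathcomp Require Import all_boot all_order all_algebra all_fingroup.
From mathcomp Require Import boolp reals.
Set Implicit Arguments. Unset Strict Implicit. Unset Printing Implicit Defensive.
Import Order.TTheory GRing.Theory Num.Theory.
Local Open Scope ring_scope.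

Section Geometry.
Variable R : realType.
Notation point := (R * R)%type.

(* orientation determinant: > 0 iff r lies strictly to the left of the
   directed line p -> q *)
Definition orient (p q r : point) : R :=
  (q.1 - p.1) * (r.2 - p.2) - (q.2 - p.2) * (r.1 - p.1).

Definition on_seg (a b x : point) : Prop :=
  exists t : R, 0 <= t <= 1 /\
    x.1 = a.1 + t * (b.1 - a.1) /\ x.2 = a.2 + t * (b.2 - a.2).

Variable N : nat.

Definition on_edge (P : 'I_N -> point) (e : {set 'I_N}) (x : point) : Prop :=
  exists u v, e = [set u; v] /\ on_seg (P u) (P v) x.

(* E (a set of undirected edges) is a Hamiltonian cycle visiting the points in
   the cyclic order s 0, s 1, ..., s (N-1), s 0, and no two distinct edges
   meet except at a common endpoint (non-crossing): a simple polygon whose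
   vertex set is exactly the point set. *)
Definition is_polygonization (P : 'I_N -> point) (E : {set {set 'I_N}}) : Prop :=
  (exists s : {perm 'I_N}, E = [set [set s i; s (ordS i)] | i : 'I_N]) /\
  (forall e f, e \in E -> f \in E -> e != f ->
     forall x, on_edge P e x -> on_edge P f x ->
       exists2 v, v \in e :&: f & x = P v).

Definition polygonizations (P : 'I_N -> point) : {set {set {set 'I_N}}} :=
  [set E | `[< is_polygonization P E >]].

Definition convex_chain (P : 'I_N -> point) (A : {set 'I_N}) (sg : R) : Prop :=
  {in A &, injective (fun i => (P i).1)} /\
  (forall a b c, a \in A -> b \in A -> c \in A ->
     (P a).1 < (P b).1 -> (P b).1 < (P c).1 ->
     0 < sg * orient (P a) (P b) (P c)).
End Geometry.

Definition is_double_chain (R : realType) (n : nat)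
    (P : 'I_(2 * n) -> (R * R)%type) (U : {set 'I_(2 * n)}) : Prop :=
  injective P /\ #|U| = n /\
  (exists sg : R, (sg = 1 \/ sg = -1) /\
     convex_chain P U sg /\ convex_chain P (~: U) (- sg)) /\
  (forall u1 u2 l, u1 \in U -> u2 \in U -> l \notin U ->
     (P u1).1 < (P u2).1 -> orient (P u1) (P u2) (P l) < 0) /\
  (forall l1 l2 u, l1 \notin U -> l2 \notin U -> u \in U ->
     (P l1).1 < (P l2).1 -> 0 < orient (P l1) (P l2) (P u)).

(* The growth constant 5.610718614 = 5610718614 / 10^9, written with small
   literals (k = 1000) to avoid huge unary nat numerals. *)
Definition growth_const (R : realType) : R :=
  let k : R := 1000%:R in
  ((5610%:R * k + 718%:R) * k + 614%:R) / (k ^+ 3).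

(* Main.v *)
(** A polygonization is determined by its edges inside [U] and its edges inside
the complement [L]: each vertex has degree two, so these fix the number of edges
from each vertex to the other chain, and since edges from [U] to [L] cannot
cross, they are monotone and determined by these degrees.  Hence the number of
polygonizations is at most [f ^ 2], where [f] is the number of noncrossing linear
forests on [n] points in convex position.

Such a forest is encoded by a word of length [n] with one letter per point: the
largest point of each path carries a letter recording the number [m] of vertices
and the shape of the path, the other points carry a blank.  As there are [1]
shapes for [m = 1] and [m * 2 ^ (m - 3)] for [m >= 2], giving the weight [x ^ m]
to a letter of size [m] yields [f * x ^ n <= phi x ^ n] for [0 < x < 1 / 2],
where [phi x = 1 + 3 x / 4 + x / (4 (1 - 2 x) ^ 2)].  The minimum of
[phi x / x], attained near [x = 0.28398], is about [5.6107186133]. *)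

Require Import Defs.
From HB Require Import structures.
From mathcomp Require Import all_boot all_order all_algebra all_fingroup.
From mathcomp Require Import boolp reals.
From mathcomp Require Import zify ring lra.
Set Implicit Arguments. Unset Strict Implicit. Unset Printing Implicit Defensive.
Import Order.TTheory GRing.Theory Num.Theory.

(** * Paths as sequences *)

Section Steps.
Variable T : eqType.
Implicit Types (p c : seq T) (x y : T) (F : seq (seq T)) (U : pred T).

Definition steps p := zip p (behead p).

Lemma steps_cons2 x y p : steps (x :: y :: p) = (x, y) :: steps (y :: p).
Proof. by []. Qed.

Lemma steps_mem x y p : (x, y) \in steps p -> x \in p /\ y \in p.
Proof.
elim: p => [|a [|b p] IH] //; rewrite steps_cons2 !inE.
case/orP=> [/eqP[-> ->]|/IH[]]; first by rewrite !eqxx orbT.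
by rewrite !inE => /orP[]-> /orP[]->; rewrite ?orbT.
Qed.

Lemma steps_rcons x y p : steps (rcons (rcons p x) y) = rcons (steps (rcons p x)) (x, y).
Proof. by elim: p => [|a [|b p] IH] //=; rewrite -IH. Qed.

Lemma steps_rev x y p : ((x, y) \in steps (rev p)) = ((y, x) \in steps p).
Proof.
elim: p => [|a [|b p] IH] //.
rewrite !rev_cons steps_rcons steps_cons2 mem_rcons !inE -rev_cons IH.
by congr (_ || _); rewrite !xpair_eqE andbC.
Qed.

Lemma steps_sorted (e : rel T) p :
  (forall x y, (x, y) \in steps p -> e x y) -> sorted e p.
Proof.
elim: p => [|a [|b p] IH] // H; rewrite [sorted _ _]/= H ?inE ?eqxx //=.
by apply: IH => x y xy; apply: H; rewrite steps_cons2 inE xy orbT.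
Qed.

(** The sequence is cut at every entry outside [U]; the maximal runs that remain are the paths a
    chain inherits from a cycle. An entry in [U] joins the run of its successor or opens a new
    one. *)
Lemma runs_exist U c : exists F,
  [/\ flatten F = filter U c, [::] \notin F &
      flatten (map steps F) = [seq xy <- steps c | U xy.1 && U xy.2]].
Proof.
elim: c => [|x c [F [F1 F2 F3]]]; first by exists [::].
have [Ux|Ux] := boolP (U x); last first.
  exists F; split=> //=; first by rewrite (negPf Ux).
  by rewrite F3; case: c {F1 F3} => [|y c] //; rewrite steps_cons2 /= (negPf Ux).
case: c F1 F3 => [|y c] F1 F3; first by exists ([:: x] :: F); rewrite /= Ux F1 F3.
have [Uy|Uy] := boolP (U y); last first.
  exists ([:: x] :: F); rewrite steps_cons2 /= Ux F1 F3 /=.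
  by rewrite (negPf Uy).
case: F F1 F2 F3 => [|[|z p] F]; rewrite [filter _ _]/= Uy // => -[-> F1] F2 F3.
exists ((x :: y :: p) :: F); rewrite steps_cons2.
split; [by rewrite [filter _ _]/= Ux Uy -F1 | by [] | by rewrite /= Ux Uy -F3].
Qed.

Lemma uniq_flatten_inj F p q x :
  uniq (flatten F) -> p \in F -> q \in F -> x \in p -> x \in q -> p = q.
Proof.
elim: F => // r F IH; rewrite /= cat_uniq => /and3P[_ /hasPn Hr uF].
have out s : s \in F -> x \in s -> x \notin r.
  by move=> sF xs; apply: Hr; apply/flattenP; exists s.
rewrite !inE => /predU1P[->|pF] /predU1P[->|qF] xp xq //.
- by move: (out _ qF xq); rewrite xp.
- by move: (out _ pF xp); rewrite xq.
exact: IH.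
Qed.

Lemma uniq_flatten_sub F p : uniq (flatten F) -> p \in F -> uniq p.
Proof.
elim: F => // r F IH; rewrite /= cat_uniq => /and3P[ur _ uF].
by rewrite inE => /predU1P[->|/IH->].
Qed.

(** Once the places satisfying [f] are known, the two subsequences can be interleaved in only one
    way. *)
Lemma filter_interleave (f : pred T) p q :
  map f p = map f q -> filter f p = filter f q ->
  filter (predC f) p = filter (predC f) q -> p = q.
Proof.
elim: p q => [|x p IH] [|y q] //= [fxy mpq]; rewrite -fxy.
by case: (f x) => /= [[-> E1]|E1] => [E2|[-> E2]]; rewrite (IH q).
Qed.

(** Some step of the path changes the value of [Q]; symmetry of [e] lets it be read from the side of
    [Q], whichever of [x] and [y] comes first. *)
Lemma sorted_switch (e : rel T) (Q : pred T) p x y :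
  symmetric e -> sorted e p -> x \in p -> y \in p -> Q x -> ~~ Q y ->
  exists a b, [/\ a \in p, b \in p, e a b, Q a & ~~ Q b].
Proof.
move=> esym; elim: p x y => [|a [|b p] IH] x y //.
  by rewrite !inE => _ /eqP-> /eqP-> ->.
move=> s; move: (s) => /= /andP[eab sp] xp yp Qx Qy.
have sub z : z \in b :: p -> z \in a :: b :: p by move=> zp; rewrite inE zp orbT.
have [Qab|Qab] := eqVneq (Q a) (Q b).
  have mv z : z \in a :: b :: p -> exists2 z', z' \in b :: p & Q z' = Q z.
    by rewrite inE => /predU1P[->|zp]; [exists b; rewrite ?inE ?eqxx | exists z].
  have [x' x'p Qx'] := mv _ xp; have [y' y'p Qy'] := mv _ yp.
  have [||c [d [cp dp ecd Qc Qd]]] := IH _ _ sp x'p y'p; rewrite ?Qx' ?Qy' //.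
  by exists c, d; split; rewrite ?sub.
have [Qa|Qa] := boolP (Q a); [exists a, b | exists b, a];
  by split; rewrite ?inE ?eqxx ?orbT // 1?esym //; move: Qab; rewrite ?Qa ?(negPf Qa); case: (Q b).
Qed.

End Steps.

Lemma steps_traject (T : eqType) (f : T -> T) x m :
  steps (traject f x m) = [seq (a, f a) | a <- traject f x m.-1].
Proof. by case: m => // m; elim: m x => // m IH x; rewrite !trajectS steps_cons2 -trajectS IH. Qed.

(** The cut between [x] and [y] is kept because its two sides will serve as disjoint paths. *)
Lemma pairwise_split (T : eqType) (r : rel T) p :
  (forall p1 p2 x y, p = p1 ++ p2 -> x \in p1 -> y \in p2 -> r x y) -> pairwise r p.
Proof.
elim: p => // x p IH H /=; apply/andP; split.
  by apply/allP => y yp; apply: (H [:: x] p); rewrite ?inE.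
by apply: IH => p1 p2 a b Ep ap bp; apply: (H (x :: p1) p2); rewrite ?Ep ?inE ?ap ?orbT.
Qed.

(** * Disjoint noncrossing paths on ordered points *)

Section Noncrossing.
Variables (n : nat) (e : rel 'I_n).
Hypothesis e_sym : symmetric e.
Hypothesis e_nc : forall x y z t : 'I_n, e x z -> e y t -> x < y < z -> z < t -> False.

(** A discrete Jordan argument: some edge of [p] leaves the interval from [y] to [t], its ends then
    separate [y] from [t], and so an edge of [q] crosses it. *)
Lemma noncrossing_paths p q (x y z t : 'I_n) :
  sorted e p -> sorted e q -> (forall v, v \in p -> v \in q -> False) ->
  x \in p -> z \in p -> y \in q -> t \in q -> x < y < z -> z < t -> False.
Proof.
move=> sp sq dis xp zp yq tq xyz zt.
have out u v : u \in p -> v \in q -> nat_of_ord u <> v.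
  by move=> up vq /val_inj uv; apply: (dis u); rewrite // uv.
have [||a [b [ap bp eab aI bO]]] := @sorted_switch _ e (fun v => y < v < t) p z x e_sym sp zp xp.
- by clear - xyz zt; lia.
- by clear - xyz; lia.
have {out}: [/\ nat_of_ord b <> y & nat_of_ord b <> t] by split; apply: out.
move=> [b_y bt]; have eba : e b a by rewrite e_sym.
(* As [a] is inside the interval and [b] outside, they enclose exactly one of [y] and [t]: [y] if
   [b < y], and [t] otherwise. *)
have [lt_by|le_yb] := ltnP b y.
  have [||c [d [cq dq ecd cI dO]]] := @sorted_switch _ e (fun v => b < v < a) q y t e_sym sq yq tq.
  - by clear - lt_by aI; lia.
  - by clear - aI; lia.
  have edc : e d c by rewrite e_sym.
  have [ad bd] : nat_of_ord a <> d /\ nat_of_ord b <> d.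
    by split=> /val_inj ed; apply: (dis d); rewrite -?ed // ?ed.
  have [lt_db|le_bd] := ltnP d b.
    by apply: (e_nc edc eba); clear - lt_db cI; lia.
  by apply: (e_nc eba ecd); clear - le_bd cI dO ad bd; lia.
have [||c [d [cq dq ecd cI dO]]] := @sorted_switch _ e (fun v => a < v < b) q t y e_sym sq tq yq.
- by clear - le_yb aI bO b_y bt; lia.
- by clear - aI; lia.
have edc : e d c by rewrite e_sym.
have [ad bd] : nat_of_ord a <> d /\ nat_of_ord b <> d.
  by split=> /val_inj ed; apply: (dis d); rewrite -?ed // ?ed.
have [lt_da|le_ad] := ltnP d a.
  by apply: (e_nc edc eab); clear - lt_da cI; lia.
by apply: (e_nc eab ecd); clear - le_ad cI dO ad bd; lia.
Qed.

End Noncrossing.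

Lemma count_lt (T : eqType) (a b : pred T) p y :
  subpred a b -> y \in p -> b y -> ~~ a y -> count a p < count b p.
Proof.
move=> sab + bby nay; elim: p => // x p IH; rewrite inE /=.
case/predU1P=> [<-|/IH]; first by rewrite bby (negPf nay) add0n ltnS sub_count.
by case ax: (a x); rewrite ?(sab x ax) // add0n => /leq_trans-> //; rewrite leq_addl.
Qed.

(** * The shape of a noncrossing path *)

Section Codes.
Variable n : nat.
Implicit Types (p q : seq 'I_n) (F : seq (seq 'I_n)) (h l i y : 'I_n).

Definition between h l y := h < y < l.

(* Along a noncrossing path from [h] to [l], the points outside the interval are
   visited downwards from [h] to the minimum, then downwards from the maximum to
   [l]; this key increases in that order. *)
Definition outer_key h y := if y <= h then h - y else h + n - y.

Definition oriented p := if p is x :: p' then x <= last x p' else false.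

Section Order.
Variables (e : rel 'I_n) (p : seq 'I_n) (i : 'I_n).
Hypothesis e_sym : symmetric e.
Hypothesis e_nc : forall x y z t : 'I_n, e x z -> e y t -> x < y < z -> z < t -> False.
Hypotheses (p_e : sorted e p) (p_uniq : uniq p) (p_or : oriented p).
Let h := head i p.
Let l := last i p.

(** Each half of a cut path keeps one endpoint, so [h], [u] on one side and [v], [l] on the other
    are four points to which [noncrossing_paths] can apply. *)
Lemma split_ends p1 p2 u v : p = p1 ++ p2 -> u \in p1 -> v \in p2 ->
  [/\ h \in p1, l \in p2 & h <= l] /\
  [/\ sorted e p1, sorted e p2 & forall x, x \in p1 -> x \in p2 -> False].
Proof.
move=> Ep up vp; move: p_e p_uniq p_or; rewrite {}/h {}/l Ep cat_uniq.
move=> /cat_sorted2[s1 s2] /and3P[_ /hasPn dis _] or; do 2!split=> //.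
- by case: (p1) up => // a s _; rewrite inE eqxx.
- by rewrite last_cat; case: (p2) vp => // a s _; rewrite last_cons mem_last.
- by move: or; case: (p1) up.
by move=> x xp1 /dis; rewrite xp1.
Qed.

(** If [v < u] with [u] visited first, then [h < v < u < l] alternates between the two halves of the
    path. *)
Lemma between_increasing :
  pairwise (fun u v : 'I_n => between h l u && between h l v ==> (u < v)) p.
Proof.
apply: pairwise_split => p1 p2 u v Ep up vp; apply/implyP.
have [[hp lp hl] [s1 s2 dis]] := split_ends Ep up vp.
case/andP=> /andP[hu ul] /andP[hv vl]; rewrite ltnNge; apply/negP => le_vu.
have uv : nat_of_ord u <> v by move/val_inj=> uv; apply: (dis u); rewrite // uv.
by apply: (noncrossing_paths e_sym e_nc s1 s2 dis hp up vp lp); clear - hu ul hv vl le_vu uv; lia.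
Qed.

Lemma outer_increasing :
  pairwise (fun u v : 'I_n => ~~ between h l u && ~~ between h l v ==>
                     (outer_key h u < outer_key h v)) p.
Proof.
apply: pairwise_split => p1 p2 u v Ep up vp; apply/implyP.
have [[hp lp hl] [s1 s2 dis]] := split_ends Ep up vp.
have dis' x : x \in p2 -> x \in p1 -> False by move=> x2 x1; apply: (dis x).
have ne x y : x \in p1 -> y \in p2 -> nat_of_ord x <> y.
  by move=> xp yp /val_inj xy; apply: (dis x); rewrite // xy.
have := ne _ _ up vp; have := ne _ _ up lp; have := ne _ _ hp vp.
have := ne _ _ hp lp; have := ltn_ord u; have := ltn_ord v.
rewrite /between /outer_key => vn un hl' hv ul uv out.
rewrite ltnNge; apply/negP => le_vu.
have nc1 := noncrossing_paths e_sym e_nc s1 s2 dis.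
have nc2 := noncrossing_paths e_sym e_nc s2 s1 dis'.
(* When the key does not increase, the alternating quadruples are [u < v < h < l], [v < h < l < u]
   and [h < l < u < v]. The case [u <= h < v] is excluded by the key itself, since [v < n]. *)
case: (leqP u h) le_vu => uh; case: (leqP v h) => vh le_vu.
- by apply: (nc1 u v h l) => //; clear - le_vu uh vh hl hl' hv ul uv; lia.
- by clear - le_vu uh vh vn; lia.
- by apply: (nc2 v h l u) => //; clear - out uh vh hl hl' hv ul uv; lia.
by apply: (nc1 h l u v) => //; clear - le_vu out un vn uh vh hl hl' hv ul uv; lia.
Qed.

End Order.

Lemma sorted_filter_key (f : pred 'I_n) (k : 'I_n -> nat) p :
  pairwise (fun u v : 'I_n => f u && f v ==> (k u < k v)) p ->
  sorted (relpre k ltn) (filter f p).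
Proof.
move=> H; rewrite sorted_pairwise; last by move=> x y z; apply: ltn_trans.
elim: p H => //= x p IH /andP[/allP xp /IH pp].
case fx: (f x) => //=; rewrite pp andbT; apply/allP => y.
by rewrite mem_filter => /andP[fy /xp]; rewrite fx fy.
Qed.

Lemma sorted_filter_eq (f : pred 'I_n) (k : 'I_n -> nat) p q :
  pairwise (fun u v : 'I_n => f u && f v ==> (k u < k v)) p ->
  pairwise (fun u v : 'I_n => f u && f v ==> (k u < k v)) q ->
  p =i q -> filter f p = filter f q.
Proof.
move=> /sorted_filter_key sp /sorted_filter_key sq pq.
apply: (irr_sorted_eq (leT := relpre k ltn)) => //.
- by move=> x y z; apply: ltn_trans.
- by move=> x /=; rewrite ltnn.
by move=> x; rewrite !mem_filter pq.
Qed.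

(* The number of vertices, the rank of the first endpoint, and the positions in
   the path of the vertices lying between the two endpoints; [i] is only the
   default value of [head], [last] and [nth]. *)
Definition code i p : 'I_n.+1 * 'I_n.+1 * {set 'I_n} :=
  (inord (size p), inord (count (fun y : 'I_n => y < head i p) p),
   [set t : 'I_n | (t < size p) && between (head i p) (last i p) (nth i p t)]).

Lemma uniq_size_ord p : uniq p -> size p <= n.
Proof. by move/card_uniqP => <-; rewrite -[leqRHS]card_ord max_card. Qed.

Lemma oriented_ends i p : oriented p ->
  [/\ head i p \in p, last i p \in p & head i p <= last i p].
Proof. by case: p => //= a p ap; rewrite inE eqxx mem_last. Qed.

Lemma oriented_lt i p : uniq p -> oriented p -> 1 < size p -> head i p < last i p.
Proof.
case: p => [|a [|b p]] //= /andP[ap _] le_a _; rewrite ltn_neqAle le_a andbT.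
by apply: contraNneq ap => /val_inj->; exact: mem_last.
Qed.

(** On a known vertex set the rank gives the first endpoint, and the number of recorded positions
    then gives the last one. The vertices between the endpoints and the others each come in a forced
    order, and the positions say how to interleave them. *)
Lemma code_inj (e e' : rel 'I_n) i p q :
  symmetric e -> symmetric e' ->
  (forall x y z t : 'I_n, e x z -> e y t -> x < y < z -> z < t -> False) ->
  (forall x y z t : 'I_n, e' x z -> e' y t -> x < y < z -> z < t -> False) ->
  sorted e p -> sorted e' q -> uniq p -> uniq q -> oriented p -> oriented q ->
  p =i q -> code i p = code i q -> p = q.
Proof.
move=> es es' enc enc' sp sq up uq op oq pq [/(congr1 val) + /(congr1 val)].
have szp := uniq_size_ord up; have szq := uniq_size_ord uq.
have cp (f : pred 'I_n) r : uniq r -> count f r < n.+1.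
  by move=> ur; rewrite ltnS (leq_trans (count_size _ _)) // uniq_size_ord.
rewrite /= !inordK ?cp // => sz rk /setP eS.
have ppq : perm_eq p q by apply: uniq_perm.
have count_pq f : count f p = count f q by apply/seq.permP.
have [hp lp _] := oriented_ends i op.
have [+ + _] := oriented_ends i oq; rewrite -!pq => hq lq.
have eh : head i p = head i q.
  apply/val_inj => /=; rewrite -count_pq in rk.
  case: (ltngtP (head i p) (head i q)) => // lt_h; exfalso.
    suff: count (fun y : 'I_n => y < head i p) p < count (fun y : 'I_n => y < head i q) p
      by rewrite rk ltnn.
    by apply: (count_lt _ hp) => //=; rewrite ?ltnn // => y /ltn_trans->.
  suff: count (fun y : 'I_n => y < head i q) p < count (fun y : 'I_n => y < head i p) p
      by rewrite rk ltnn.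
  by apply: (count_lt _ hq) => //=; rewrite ?ltnn // => y /ltn_trans->.
have em : map (between (head i p) (last i p)) p = map (between (head i q) (last i q)) q.
  apply: (@eq_from_nth _ false); rewrite !size_map // => t tp.
  rewrite !(nth_map i) -?sz //.
  have := eS (Ordinal (leq_trans tp szp)).
  by rewrite !inE /= -sz tp.
(* Of two candidates for the last endpoint, the larger one encloses the smaller in addition to what
   the smaller encloses, so the counts differ. *)
have el : last i p = last i q.
  have := congr1 (count id) em; rewrite !count_map -count_pq -eh => ec.
  have {ec} : count (between (head i p) (last i p)) p =
         count (between (head i p) (last i q)) p by exact: ec.
  have [lt1|le1] := ltnP 1 (size p); last first.
    by case: (p) le1 lp lq => [|x []] //; rewrite !inE => _ /eqP-> /eqP->.
  have hl := oriented_lt i up op lt1.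
  have := oriented_lt i uq oq; rewrite -sz -eh => /(_ lt1) hl'.
  case: (ltngtP (last i p) (last i q)) => [lt_l|lt_l|/val_inj//] ec; exfalso.
    suff: count (between (head i p) (last i p)) p < count (between (head i p) (last i q)) p
      by rewrite ec ltnn.
    apply: (count_lt _ lp); rewrite /between ?ltnn ?andbF ?hl //.
    by move=> y /andP[-> /= /ltn_trans->].
  suff: count (between (head i p) (last i q)) p < count (between (head i p) (last i p)) p
      by rewrite ec ltnn.
  apply: (count_lt _ lq); rewrite /between ?ltnn ?andbF ?hl' //.
  by move=> y /andP[-> /= /ltn_trans->].
apply: (@filter_interleave _ (between (head i p) (last i p))).
- by rewrite em eh el.
- apply: (@sorted_filter_eq _ (@nat_of_ord n)) => //.
    exact: (between_increasing i es enc sp up op).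
  by rewrite eh el; exact: (between_increasing i es' enc' sq uq oq).
apply: (@sorted_filter_eq _ (outer_key (head i p))) => //.
  exact: (outer_increasing i es enc sp up op).
by rewrite eh el; exact: (outer_increasing i es' enc' sq uq oq).
Qed.

End Codes.

(** * Encoding forests by words *)

Section Forests.
Variable n : nat.
Implicit Types (p q : seq 'I_n) (F : seq (seq 'I_n)) (i j k m x y : 'I_n).
Implicit Types (G : {set 'I_n * 'I_n}).

Definition path_cover F := uniq (flatten F) /\ forall i, i \in flatten F.

(** Symmetrized so that reversing or reordering the paths does not change the graph. *)
Definition graph F : {set 'I_n * 'I_n} :=
  [set xy | (xy \in flatten (map (@steps _) F)) ||
            ((xy.2, xy.1) \in flatten (map (@steps _) F))].

Definition noncrossing G :=
  forall x y z t : 'I_n, (x, z) \in G -> (y, t) \in G -> x < y < z -> z < t -> False.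

Definition block F i := nth [::] F (find (fun p => i \in p) F).

Definition top p i := all (fun j => j <= i) p.

Definition word F : {ffun 'I_n -> option ('I_n.+1 * 'I_n.+1 * {set 'I_n})} :=
  [ffun i => if top (block F i) i then Some (code i (block F i)) else None].

Lemma graphP F x y :
  reflect (exists2 p, p \in F & (x, y) \in steps p \/ (y, x) \in steps p)
          ((x, y) \in graph F).
Proof.
rewrite inE; apply: (iffP orP) => [[]/flatten_mapP[p pF xy]|[p pF [xy|xy]]].
- by exists p; rewrite // xy; left.
- by exists p; rewrite // xy; right.
- by left; apply/flatten_mapP; exists p.
by right; apply/flatten_mapP; exists p.
Qed.

Lemma graph_sym F : symmetric (fun x y => (x, y) \in graph F).
Proof. by move=> x y; rewrite !inE orbC. Qed.

Lemma orient_forest F : path_cover F -> [::] \notin F ->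
  exists F', [/\ path_cover F', all (@oriented n) F' & graph F' = graph F].
Proof.
move=> [uF cF] F0; pose f p := if oriented p then p else rev p.
have pf p : perm_eq (f p) p by rewrite /f; case: ifP => _; rewrite ?perm_refl ?perm_rev.
have pF : perm_eq (flatten (map f F)) (flatten F).
  by elim: {uF cF F0} F => //= p F IH; apply: perm_cat.
exists (map f F); split.
- by split=> [|i]; rewrite ?(perm_uniq pF) ?(perm_mem pF).
- rewrite all_map; apply/allP => p pF'; rewrite /= /f; case: ifP => //.
  case: p pF' => [|a p] pF'; first by rewrite pF' in F0.
  rewrite /= => /negbT; case/lastP: p {pF'} => [|p b]; first by rewrite leqnn.
  rewrite last_rcons -ltnNge rev_cons rev_rcons /= last_rcons; exact: ltnW.
apply/setP=> -[x y]; apply/graphP/graphP => [[p /mapP[q qF ->]]|[p pF' xy]].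
  move=> xy; exists q => //; move: xy; rewrite /f; case: ifP => // _.
  by rewrite !steps_rev => -[]; [right|left].
exists (f p); first exact: map_f.
by rewrite /f; case: ifP => // _; rewrite !steps_rev; case: xy; [right|left].
Qed.

Lemma block_has F i : path_cover F -> has (fun p => i \in p) F.
Proof. by case=> _ /(_ i) /flattenP[p pF ip]; apply/hasP; exists p. Qed.

Lemma mem_block F i : path_cover F -> block F i \in F.
Proof. by move=> /(block_has i) H; rewrite mem_nth // -has_find. Qed.

Lemma block_mem F i : path_cover F -> i \in block F i.
Proof. by move=> /(block_has i) H; exact: (nth_find [::] H). Qed.

Lemma block_eq F i p : path_cover F -> p \in F -> i \in p -> block F i = p.
Proof.
move=> cF pF ip; apply: (uniq_flatten_inj (x := i) cF.1) => //.
  exact: mem_block.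
exact: block_mem.
Qed.

Lemma top_exists p i : i \in p -> exists2 j, j \in p & top p j.
Proof.
move=> ip; case: (arg_maxnP (fun j : 'I_n => nat_of_ord j) ip) => j jp jm.
by exists j => //; apply/allP.
Qed.

Lemma graph_sorted F p : p \in F -> sorted (fun x y => (x, y) \in graph F) p.
Proof. by move=> pF; apply: steps_sorted => x y xy; apply/graphP; exists p; auto. Qed.

(* If [block F i] is closed at [i], then it is made of [i] and of the largest
   points not belonging to a block closed before [i]. *)
Lemma block_upper F i j k : path_cover F -> noncrossing (graph F) ->
  top (block F i) i -> j \in block F i -> j < k < i ->
  (forall m, m < i -> top (block F m) m -> k \notin block F m) -> k \in block F i.
Proof.
move=> cF ncF ti ji /andP[jk ki] open_k.
have bk := block_mem k cF.
have [m mk tm] := top_exists bk; have bm := block_eq cF (mem_block k cF) mk.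
have le_im : i <= m.
  rewrite leqNgt; apply/negP => lt_mi; have := open_k m lt_mi.
  by rewrite bm bk => /(_ tm).
move: le_im; rewrite leq_eqVlt => /predU1P[/val_inj->|lt_im]; first by rewrite bm.
apply/negPn/negP => nki.
have dis v : v \in block F i -> v \in block F k -> False.
  move=> vi vk; case/negP: nki; rewrite -(block_eq cF (mem_block i cF) vi).
  by rewrite (block_eq cF (mem_block k cF) vk).
apply: (noncrossing_paths (@graph_sym F) ncF (graph_sorted (mem_block i cF))
  (graph_sorted (mem_block k cF)) dis ji (block_mem i cF) bk mk) => //.
by rewrite jk.
Qed.

(** A converse to [block_upper]: blocks are disjoint, so a point of a block with maximum [i] lies in
    no block with a smaller maximum. *)
Lemma block_open F i k : path_cover F -> top (block F i) i -> k \in block F i -> k != i ->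
  k < i /\ forall m, m < i -> top (block F m) m -> k \notin block F m.
Proof.
move=> cF ti ki ne; split.
  by rewrite ltn_neqAle ne; move/allP: ti => /(_ k ki).
move=> m mi /allP tm; apply/negP => km.
have := block_eq cF (mem_block m cF) km.
rewrite (block_eq cF (mem_block i cF) ki) => E.
by move: (tm i); rewrite -E => /(_ (block_mem i cF)); rewrite leqNgt mi.
Qed.

(** The word is decoded from left to right, by strong induction on [i]: the blocks closed before [i]
    agree, which fixes the open points. The letter at [i] gives the size of the block, hence its
    vertex set, and [code_inj] gives the path. *)
Lemma block_decode F F' i : path_cover F -> path_cover F' ->
  all (@oriented n) F -> all (@oriented n) F' ->
  noncrossing (graph F) -> noncrossing (graph F') ->
  word F = word F' -> top (block F i) i -> block F i = block F' i.
Proof.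
move=> cF cF' oF oF' ncF ncF' eqw.
have [m] := ubnP (nat_of_ord i); elim: m i => // m IH i; rewrite ltnS => le_im ti.
have eqt j : top (block F j) j = top (block F' j) j.
  by move/ffunP/(_ j): eqw; rewrite !ffunE; case: (top (block F j) j); case: (top (block F' j) j).
have eqb j : j < i -> top (block F j) j -> block F j = block F' j.
  by move=> lt_ji; apply: IH; exact: leq_trans lt_ji le_im.
have ti' : top (block F' i) i by rewrite -eqt.
have ec : code i (block F i) = code i (block F' i).
  by move/ffunP/(_ i): eqw; rewrite !ffunE ti ti' => /Some_inj.
have uF j : uniq (block F j) := uniq_flatten_sub cF.1 (mem_block j cF).
have uF' j : uniq (block F' j) := uniq_flatten_sub cF'.1 (mem_block j cF').
have sz : size (block F i) = size (block F' i).
  move: ec => -[/(congr1 val) + _ _].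
  by rewrite /= !inordK ?ltnS ?uniq_size_ord.
have bi := block_mem i cF; have bi' := block_mem i cF'.
have up j k : j \in block F i -> k \in block F' i -> k != i -> j < k -> k \in block F i.
  move=> jF kF' ki jk; have [lt_ki op] := block_open cF' ti' kF' ki.
  apply: (block_upper cF ncF ti jF); rewrite ?jk // => l li tl.
  by rewrite eqb // op // -eqt.
have up' j k : j \in block F' i -> k \in block F i -> k != i -> j < k -> k \in block F' i.
  move=> jF kF' ki jk; have [lt_ki op] := block_open cF ti kF' ki.
  apply: (block_upper cF' ncF' ti' jF); rewrite ?jk // => l li tl.
  by rewrite -eqb // ?op // eqt.
have eqm : block F i =i block F' i.
  (* Upper sets of the same ordered set are nested, and nested blocks of equal size coincide. *)
  have [/allP sub|/allPn[x xF xF']] := boolP (all (mem (block F' i)) (block F i)).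
    by have [] := uniq_min_size (uF i) sub; rewrite sz.
  have sub : {subset block F' i <= block F i}.
    move=> y yF'; have [-> //|yi] := eqVneq y i.
    case: (ltngtP x y) => [xy|yx|/val_inj xy]; first exact: up xF yF' yi xy.
      have xi : x != i by apply: contraNneq xF' => ->.
      by case/negP: xF'; exact: up' yF' xF xi yx.
    by move: xF'; rewrite xy /= yF'.
  have [|_ E] := uniq_min_size (uF' i) sub; first by rewrite sz.
  by move=> z; rewrite E.
have op := allP oF _ (mem_block i cF); have op' := allP oF' _ (mem_block i cF').
exact: (code_inj (@graph_sym F) (@graph_sym F') ncF ncF'
  (graph_sorted (mem_block i cF)) (graph_sorted (mem_block i cF')) _ _ op op' eqm ec).
Qed.

Lemma word_inj_sub F F' : path_cover F -> path_cover F' ->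
  all (@oriented n) F -> all (@oriented n) F' ->
  noncrossing (graph F) -> noncrossing (graph F') ->
  word F = word F' -> graph F \subset graph F'.
Proof.
move=> cF cF' oF oF' ncF ncF' eqw; apply/subsetP=> -[x y] /graphP[p pF xy].
apply/graphP; have xp : x \in p by case: xy => /steps_mem[].
have [i ip ti] := top_exists xp.
rewrite -(block_eq cF pF ip) in ti xy.
exists (block F' i); first exact: mem_block.
by rewrite -(block_decode cF cF' oF oF' ncF ncF' eqw ti).
Qed.

Definition letter_size (c : option ('I_n.+1 * 'I_n.+1 * {set 'I_n})) : nat :=
  if c is Some (m, _, _) then m else 0.

(** The endpoints occupy positions [0] and [m - 1], so these never belong to [A]. For [m = 1] the
    truncated [m - 2] leaves only [a = 0] with [A] empty. *)
Definition valid_letter (c : option ('I_n.+1 * 'I_n.+1 * {set 'I_n})) :=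
  if c is Some (m, a, A) then
    [&& 0 < m, A \subset [set t : 'I_n | 0 < t < m.-1] & a + #|A| <= m - 2]
  else true.

Lemma count_classes (T : eqType) (a b c d : pred T) (s : seq T) :
  (forall z, a z + b z + c z + d z <= 1) ->
  count a s + count b s + count c s + count d s <= size s.
Proof. by move=> H; elim: s => //= z s IH; have := H z; clear - IH; lia. Qed.

Lemma code_valid i p : i \in p -> uniq p -> oriented p -> valid_letter (Some (code i p)).
Proof.
move=> ip up op; have szp := uniq_size_ord up.
have cp (f : pred 'I_n) : count f p < n.+1.
  by rewrite ltnS (leq_trans (count_size _ _)) // uniq_size_ord.
have [hp lp hl] := oriented_ends i op.
rewrite /valid_letter /code !inordK //.
set A := [set t : 'I_n | _].
apply/and3P; split; first by case: (p) ip.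
  apply/subsetP=> t; rewrite !inE => /and3P[tp ht tl]; apply/andP; split.
    by rewrite lt0n; apply: contraTneq ht => ->; rewrite nth0 ltnn.
  rewrite ltn_neqAle; apply/andP; split; last by clear - tp; lia.
  by apply: contraTneq tl => ->; rewrite nth_last ltnn.
have [lt1|le1] := ltnP 1 (size p); last first.
  rewrite /A; case: (p) le1 ip => [|a []] // _ _.
  rewrite /= ltnn /= addn0 add0n leqn0 cards_eq0; apply/eqP/setP => t.
  by rewrite !inE /between; case: (val t) => [|[]] //=; rewrite ltnn andbF.
have {}hl := oriented_lt i up op lt1.
have cA : #|A| <= count (between (head i p) (last i p)) p.
  rewrite -size_filter; apply: leq_trans (card_size _).
  rewrite -(@card_in_imset _ _ (fun t : 'I_n => nth i p t) A) => [|t u].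
    apply: subset_leq_card; apply/subsetP => y /imsetP[t].
    by rewrite inE => /andP[tp bt] ->; rewrite mem_filter bt mem_nth.
  rewrite !inE => /andP[tp _] /andP[tu _] /eqP.
  by rewrite nth_uniq // => /eqP/val_inj.
(* The vertices below the first endpoint, those between the endpoints, and the two endpoints form
   four disjoint classes, whence [a + #|A| + 2 <= m]. *)
have := @count_classes _ (fun y : 'I_n => y < head i p) (between (head i p) (last i p))
          (pred1 (head i p)) (pred1 (last i p)) p.
have c1 y : y \in p -> 0 < count (pred1 y) p by rewrite -has_count has_pred1.
have := c1 _ hp; have := c1 _ lp.
have cl x : (x < head i p) + between (head i p) (last i p) x +
    pred1 (head i p) x + pred1 (last i p) x <= 1.
  rewrite /between /= -!(inj_eq val_inj) /=; clear - hl; lia.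
move=> ll lh /(_ cl); move: cA ll lh lt1.
move: (count _ p) (count _ p) (count _ p) (count _ p) (#|A|) (size p) => a b c d k m; clear; lia.
Qed.

Lemma word_valid F i : path_cover F -> all (@oriented n) F -> valid_letter (word F i).
Proof.
move=> cF oF; rewrite ffunE; case: ifP => // ti; apply: code_valid.
- exact: block_mem.
- exact: uniq_flatten_sub cF.1 (mem_block i cF).
exact: (allP oF) _ (mem_block i cF).
Qed.

(** Grouped by paths, the sum counts every vertex once: the largest point of a path contributes the
    size of the path and its other points contribute [0]. *)
Lemma word_size F : path_cover F -> \sum_i letter_size (word F i) = n.
Proof.
move=> cF; have pF : perm_eq (flatten F) (index_enum 'I_n).
  apply: uniq_perm; rewrite ?index_enum_uniq ?cF.1 // => i.
  by rewrite cF.2 mem_index_enum.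
rewrite -(perm_big _ pF) /= big_flatten /=.
transitivity (\sum_(p <- F) size p).
  rewrite big_seq [RHS]big_seq; apply: eq_bigr => p pF'.
  have [->|[k kp]] : p = [::] \/ exists k, k \in p.
    by case: (p) => [|k ?]; [left | right; exists k; rewrite inE eqxx].
    by rewrite big_nil.
  have [i ip ti] := top_exists kp; have up := uniq_flatten_sub cF.1 pF'.
  rewrite (bigD1_seq i) //= ffunE (block_eq cF pF' ip) ti /= inordK ?ltnS ?uniq_size_ord //.
  rewrite big_seq_cond big1 ?addn0 // => j /andP[jp ji].
  rewrite ffunE (block_eq cF pF' jp); case: ifP => // /allP/(_ _ ip).
  move/allP: ti => /(_ _ jp) ij ji'; case/eqP: ji; apply/val_inj/eqP.
  by rewrite eqn_leq ij ji'.
transitivity (size (flatten F)); first by rewrite size_flatten sumnE big_map.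
by rewrite -(card_uniqP cF.1) -[RHS]card_ord; apply: eq_card => i; rewrite cF.2.
Qed.

End Forests.

(** * Counting words *)

Lemma sum_ltn_ord (n k : nat) : (\sum_(i < n) (i < k) = minn n k)%N.
Proof. by elim: n => [|n IH]; rewrite ?big_ord0 ?big_ord_recr /= ?IH; lia. Qed.

Section Letters.
Variable n : nat.

Lemma card_middle (m : nat) : (m <= n)%N ->
  #|[set t : 'I_n | (0 < t < m.-1)%N]| = (m - 2)%N.
Proof.
move=> mn; rewrite -sum1_card big_mkcond /=.
under eq_bigr do rewrite inE.
suff H k : (\sum_(i < k) (if 0 < i < m.-1 then 1 else 0) = minn k m.-1 - 1)%N.
  by rewrite H; lia.
elim: k => [|k IH]; first by rewrite big_ord0; lia.
by rewrite big_ord_recr /= IH; case: ifP; lia.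
Qed.

Definition shapes (m : nat) : {set 'I_n.+1 * {set 'I_n}} :=
  [set c : 'I_n.+1 * {set 'I_n} |
    (c.2 \subset [set t : 'I_n | (0 < t < m.-1)%N]) && (c.1 + #|c.2| <= m - 2)%N].

(* For each [A] there are [m - 1 - #|A|] choices of [a].  Complementing [A] in [D]
   turns this number into [1 + #|A|], so two complementary sets contribute [m]. *)
Lemma card_shapes (m : nat) : (1 < m <= n)%N -> (2 * #|shapes m| = m * 2 ^ (m - 2))%N.
Proof.
move=> /andP[m1 mn]; set D := [set t : 'I_n | (0 < t < m.-1)%N].
have cD : #|D| = (m - 2)%N by apply: card_middle.
have -> : #|shapes m| = (\sum_(A in powerset D) (m - 1 - #|A|))%N.
  rewrite -sum1_card.
  transitivity (\sum_(a : 'I_n.+1) \sum_(A | (A \in powerset D) && (a + #|A| <= m - 2)) 1)%N.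
    rewrite pair_big_dep /=; apply: eq_bigl => c; by rewrite !inE.
  rewrite (exchange_big_dep (mem (powerset D))) /=; last by move=> a A _ /andP[].
  apply: eq_bigr => A; rewrite inE => AD; rewrite AD.
  have cA := subset_leq_card AD; rewrite cD in cA.
  rewrite big_mkcond (eq_bigr (fun a : 'I_n.+1 => (a < m - 1 - #|A|) : nat)%N) => [|a _].
    rewrite sum_ltn_ord; move: (#|A|) cA => k; clear - m1 mn; lia.
  by move: (#|A|) (nat_of_ord a) cA m1 => k b; clear; case: ifP; lia.
rewrite mul2n -addnn {1}(reindex_onto (setD D) (setD D)) /=; last first.
  by move=> A; rewrite inE => AD; rewrite setDDr setDv set0U; apply/setIidPr.
have pD A : (D :\: A \in powerset D) && (D :\: (D :\: A) == A) = (A \in powerset D).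
  rewrite !inE subsetDl setDDr setDv set0U; apply/eqP/idP => [<-|/setIidPr//].
  exact: subsetIl.
rewrite (eq_bigl _ _ pD) -big_split /= -cD -card_powerset mulnC -sum_nat_const.
apply: eq_bigr => A; rewrite inE => AD.
have := subset_leq_card AD; rewrite cardsDS // cD; move: (#|A|) => k; clear - m1; lia.
Qed.

End Letters.

(** * Weights of letters and the bound on the number of forests *)

Local Open Scope ring_scope.

(** The right-hand side is the full series; after multiplication by [(1 - y) ^+ 2] the missing tail
    is [y ^+ n * (n%:R * (1 - y) + y)], which is nonnegative. *)
Lemma sum_nX_le (R : realFieldType) (y : R) (n : nat) : 0 <= y < 1 ->
  \sum_(m < n) m%:R * y ^+ m <= y / (1 - y) ^+ 2.
Proof.
move=> /andP[y0 y1]; have d0 : 0 < 1 - y by lra.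
rewrite ler_pdivlMr ?exprn_gt0 //.
have -> : (\sum_(m < n) m%:R * y ^+ m) * (1 - y) ^+ 2 = y - y ^+ n * (n%:R * (1 - y) + y).
  elim: n => [|n IH]; first by rewrite big_ord0 expr0 !mul0r add0r mul1r subrr.
  by rewrite big_ord_recr /= mulrDl IH -natr1 [y ^+ n.+1]exprS; ring.
by rewrite gerBl mulr_ge0 ?exprn_ge0 // addr_ge0 // mulr_ge0 // ltW.
Qed.

Section Count.
Variables (R : realFieldType) (x : R).
Hypothesis x_range : 0 < x < 2^-1.

(** The function [phi]. The blank weighs [1], and the last term is the series of
    [m * (2 * x) ^ m / 8]; its term at [m = 1] is [x / 4] instead of [x], which [3 / 4 * x]
    corrects. *)
Definition letter_bound : R := 1 + 3 / 4 * x + x / (4 * (1 - 2 * x) ^+ 2).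

Lemma card_shapes_le (n m : nat) : (0 < m <= n)%N ->
  #|shapes n m|%:R * x ^+ m <= m%:R * (2 * x) ^+ m / 8 + (if m == 1%N then 3 / 4 * x else 0).
Proof.
move=> /andP[m0 mn]; have x0 : 0 < x by case/andP: x_range.
case: (ltngtP m 1%N) => [|m1|->]; first by rewrite ltnNge m0.
  rewrite addr0 exprMn mulrA -mulrAC ler_wpM2r ?exprn_ge0 ?(ltW x0) //.
  have := @card_shapes n m; rewrite m1 mn => /(_ isT).
  move/(congr1 (fun k => k%:R : R)); rewrite !natrM natrX.
  have -> : (2 ^+ m : R) = 4 * 2 ^+ (m - 2) by rewrite -[in LHS](subnKC m1) exprD; ring.
  move: (2 ^+ _) (m%:R) (#|_|%:R) => a b c E.
  by clear - E; lra.
have : (#|shapes n 1| <= #|[set ((ord0, set0) : 'I_n.+1 * {set 'I_n})]|)%N.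
  apply: subset_leq_card; apply/subsetP => -[a A]; rewrite !inE /= => /andP[_].
  rewrite leqn0 addn_eq0 cards_eq0 => /andP[/eqP a0 /eqP->].
  by rewrite xpair_eqE eqxx andbT; apply/eqP/val_inj.
rewrite cards1 -(ler_nat R) !expr1 => /(ler_wpM2r (ltW x0)) /le_trans; apply.
by clear; lra.
Qed.

Lemma letters_sum (n : nat) :
  \sum_(c : option ('I_n.+1 * 'I_n.+1 * {set 'I_n}) | valid_letter c)
     x ^+ letter_size c <= letter_bound.
Proof.
have [x0 x2] := andP x_range.
rewrite (bigD1 None) //= expr0 /letter_bound -addrA lerD2l.
rewrite (reindex_onto Some (odflt (ord0, ord0, set0))) /=; last by case.
rewrite (eq_bigl (fun c => valid_letter (Some c))) => [|c]; last by rewrite eqxx !andbT.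
rewrite (partition_big (fun c => c.1.1) predT) //=.
have le_m (m : 'I_n.+1) :
    \sum_(c : 'I_n.+1 * 'I_n.+1 * {set 'I_n} | valid_letter (Some c) && (c.1.1 == m))
       x ^+ letter_size (Some c) <=
    m%:R * (2 * x) ^+ m / 8 + (if m == 1 :> nat then 3 / 4 * x else 0).
  have [m0|m0] := posnP m.
    rewrite big1 => [|[[k a] A]]; first by rewrite m0 !mul0r add0r.
    by move=> /andP[/= /andP[+ _] /eqP km]; rewrite km m0.
  apply: le_trans (card_shapes_le _); last by rewrite m0 -ltnS /=.
  rewrite (eq_bigr (fun=> x ^+ m)) => [|[[k a] A] /andP[_ /eqP <-] //].
  rewrite sumr_const -[leLHS]mulr_natl ler_wpM2r ?exprn_ge0 ?(ltW x0) // ler_nat.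
  pose f (c : 'I_n.+1 * 'I_n.+1 * {set 'I_n}) := (c.1.2, c.2).
  rewrite -(card_in_imset (f := f)) => [|[[k a] A] [[k' a'] A']]; last first.
    by rewrite !unfold_in /= => /andP[_ /eqP->] /andP[_ /eqP->] [-> ->].
  apply: subset_leq_card; apply/subsetP => _ /imsetP[[[k a] A] + ->].
  by rewrite unfold_in inE /= => /andP[/and3P[_ sA aA] /eqP <-]; rewrite sA.
apply: le_trans (ler_sum _ (fun m _ => le_m m)) _; rewrite big_split /= addrC.
apply: lerD.
  (* The index [m = 1] exists only for [n > 0]; for [n = 0] the sum of corrections is [0]. *)
  case: (n) => [|k]; first by rewrite big_ord1 /= mulr_ge0 ?(ltW x0) //; lra.
  rewrite (bigD1 (inord 1)) //= inordK // eqxx big1 ?addr0 // => j.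
  by rewrite -(inj_eq val_inj) /= inordK // => /negPf->.
rewrite -mulr_suml.
have y01 : 0 <= 2 * x < 1 by lra.
apply: le_trans (ler_wpM2r _ (sum_nX_le n.+1 y01)) _; first by lra.
have d0 : 1 - 2 * x != 0 by apply: lt0r_neq0; lra.
by rewrite le_eqVlt; apply/orP; left; apply/eqP; field.
Qed.

(** Forests are edge sets rather than lists of paths, so that each is counted once. *)
Definition forests (n : nat) : {set {set 'I_n * 'I_n}} :=
  [set G | `[< noncrossing G /\
     exists F, [/\ path_cover F, [::] \notin F & G = graph F] >]].

(** A graph may come from several covers, so one oriented cover is chosen for each; injectivity
    holds because the word determines the graph. *)
Lemma forests_word (n : nat) :
  exists w : {set 'I_n * 'I_n} -> {ffun 'I_n -> option ('I_n.+1 * 'I_n.+1 * {set 'I_n})},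
  [/\ {in forests n &, injective w},
      forall G i, G \in forests n -> valid_letter (w G i) &
      forall G, G \in forests n -> \sum_i letter_size (w G i) = n].
Proof.
have /choice[w wP] : forall G : {set 'I_n * 'I_n}, exists F, G \in forests n ->
    [/\ path_cover F, all (@oriented n) F, noncrossing (graph F) & graph F = G].
  move=> G; have [GF|GF] := boolP (G \in forests n); last by exists [::].
  move: GF; rewrite inE => /asboolP[nc [F [cF F0 EG]]].
  by have [F' [cF' oF' EF']] := orient_forest cF F0; exists F'; split; rewrite // EF' -EG.
exists (fun G => word (w G)).
split=> [G G' /wP[c o nc E] /wP[c' o' nc' E'] eqw|G i /wP[c o _ _]|G /wP[c _ _ _]].
- by rewrite -E -E'; apply/eqP; rewrite eqEsubset !word_inj_sub.
- exact: word_valid.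
- exact: word_size.
Qed.

(** Each forest gives a word of total weight [x ^+ n], and by distributivity the weights of all
    words of length [n] sum to the [n]-th power of the sum over letters. Invalid letters get weight
    [0]. *)
Lemma forests_count (n : nat) : #|forests n|%:R * x ^+ n <= letter_bound ^+ n.
Proof.
have x0 : 0 < x by case/andP: x_range.
have [w [w_inj w_valid w_size]] := forests_word n.
pose W (c : option ('I_n.+1 * 'I_n.+1 * {set 'I_n})) :=
  if valid_letter c then x ^+ letter_size c else 0 : R.
pose wt (f : {ffun 'I_n -> option ('I_n.+1 * 'I_n.+1 * {set 'I_n})}) :=
  \prod_i W (f i).
have W0 c : 0 <= W c by rewrite /W; case: ifP => // _; rewrite exprn_ge0 ?ltW.
have -> : #|forests n|%:R * x ^+ n = \sum_(f in w @: forests n) wt f.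
  rewrite big_imset //= (eq_bigr (fun=> x ^+ n)) => [|G GF].
    by rewrite sumr_const mulr_natl.
  rewrite /wt (eq_bigr (fun i => x ^+ letter_size (w G i))) => [|i _].
    by rewrite prodrXr w_size.
  by rewrite /W w_valid.
apply: (@le_trans _ _ (\sum_f wt f)).
  rewrite big_mkcond ler_sum // => f _; case: ifP => // _.
  by apply: prodr_ge0.
rewrite /wt -(bigA_distr_bigA (fun=> W)) prodr_const card_ord.
apply: lerXn2r; rewrite ?nnegrE ?sumr_ge0 //.
  apply: le_trans (letters_sum n); apply: sumr_ge0 => c _; rewrite exprn_ge0 ?(ltW x0) //.
by rewrite /W -big_mkcond letters_sum.
Qed.

End Count.

Local Open Scope nat_scope.

Lemma set2_eq (T : finType) (x y u v : T) :
  ([set x; y] == [set u; v]) = ((x == u) && (y == v)) || ((x == v) && (y == u)).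
Proof.
apply/eqP/idP => [/setP E|/orP[]/andP[/eqP-> /eqP->] //]; last exact: setUC.
have := E x; have := E y; have := E u; have := E v; rewrite !inE !eqxx ?orbT /=.
move=> vI uI /esym/orP yI /esym/orP xI.
case: xI => /eqP xE; case: yI => /eqP yE; move: uI vI; rewrite xE yE !eqxx ?orbT ?orbb //.
  by move=> _ /eqP->; rewrite eqxx.
by move=> /eqP->; rewrite eqxx.
Qed.

(** * Hamiltonian cycles *)

Section Cycles.
Variables (N : nat) (s : {perm 'I_N}).

Definition cycle_next x := s (ordS (s^-1%g x)).

Definition cycle_edges : {set {set 'I_N}} := [set [set s i; s (ordS i)] | i : 'I_N].

Lemma cycle_edgesP x y :
  ([set x; y] \in cycle_edges) = (cycle_next x == y) || (cycle_next y == x).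
Proof.
apply/imsetP/orP => [[i _ /eqP]|].
  rewrite set2_eq /cycle_next => /orP[]/andP[/eqP-> /eqP->]; rewrite !permK eqxx; by [left | right].
case=> /eqP <-; [exists (s^-1%g x) | exists (s^-1%g y)] => //; rewrite permKV //.
by rewrite setUC.
Qed.

Lemma cycle_edges_pair e : e \in cycle_edges -> exists x y, e = [set x; y].
Proof. by case/imsetP=> i _ ->; exists (s i), (s (ordS i)). Qed.

Lemma iter_ordS (i : 'I_N) k : iter k (@ordS N) i = (i + k) %% N :> nat.
Proof.
elim: k => [|k IH]; first by rewrite addn0 modn_small.
by rewrite iterS /= IH -addn1 modnDml addn1 addnS.
Qed.

Lemma cycle_degree x : 2 < N -> #|[set y | [set x; y] \in cycle_edges]| = 2.
Proof.
move=> N2; set i := (s^-1)%g x.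
have -> : [set y | [set x; y] \in cycle_edges] = [set s (ordS i); s (ord_pred i)].
  apply/setP => y; rewrite !inE cycle_edgesP /cycle_next -/i eq_sym; congr (_ || _).
  by apply/eqP/eqP => [yx|->]; rewrite /i; [rewrite -yx permK ordSK permKV|rewrite permK ord_predK permKV].
(* If the successor and the predecessor coincided, two shifts would fix [i], which is impossible
   modulo [N > 2]. *)
rewrite cards2 (inj_eq perm_inj); case: eqP => // /(congr1 (@ordS N)); rewrite ord_predK => ii.
have : nat_of_ord (iter 2 (@ordS N) i) = i := congr1 val ii.
rewrite iter_ordS.
have [lt_iN|le_Ni] := ltnP (i + 2) N; first by rewrite modn_small //; lia.
rewrite -(subnK le_Ni) modnDr modn_small; have := ltn_ord i; lia.
Qed.

Lemma iter_cycle_next x k : iter k cycle_next x = s (iter k (@ordS N) (s^-1%g x)).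
Proof. by elim: k => [|k IH]; rewrite ?permKV // !iterS IH /cycle_next permK. Qed.

Lemma mem_cycle x y : y \in traject cycle_next x N.
Proof.
set i := s^-1%g x; set j := s^-1%g y.
(* The number of steps from [i] to [j], that is [j - i] modulo [N]. *)
apply/trajectP; exists ((j + (N - i)) %% N).
  by rewrite ltn_mod; case: (N) i => [[]|].
rewrite iter_cycle_next -/i; apply: (@perm_inj _ s^-1%g).
rewrite permK -/j; apply/val_inj; rewrite /= iter_ordS modnDmr addnCA subnKC 1?ltnW //.
by rewrite modnDr modn_small.
Qed.

Lemma cycle_uniq x : uniq (traject cycle_next x N).
Proof.
apply: (leq_size_uniq (enum_uniq 'I_N)) => [y _|]; first exact: mem_cycle.
by rewrite size_traject size_enum_ord.
Qed.

(** Opening the cycle at [x] loses only the closing step, the one that returns to [x]. *)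
Lemma cycle_next_mem x y : cycle_next y != x ->
  (y, cycle_next y) \in steps (traject cycle_next x N).
Proof.
move=> yx; have /trajectP[k kN yE] := mem_cycle x y.
have N0 : 0 < N by apply: leq_ltn_trans kN.
have kN' : k < N.-1.
  rewrite ltn_neqAle -ltnS prednK // kN andbT; apply: contraNneq yx => kE.
  rewrite yE -iterS kE prednK // iter_cycle_next; apply/eqP.
  rewrite -[RHS](permKV s); congr (s _); apply/val_inj.
  by rewrite -[LHS]/(nat_of_ord (iter N (@ordS N) _)) iter_ordS modnDr modn_small.
rewrite steps_traject.
by apply/mapP; exists y => //; apply/trajectP; exists k.
Qed.

Lemma steps_next x y z : (y, z) \in steps (traject cycle_next x N) -> cycle_next y = z.
Proof.
by rewrite steps_traject => /mapP[a _ [-> ->]].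
Qed.

(** The cycle is opened at [l], outside the image of [g], so the lost step does not join two points
    of the image. The runs inside the image, pulled back along [g], are the required paths. *)
Lemma cycle_forest n (g : 'I_n -> 'I_N) (i0 : 'I_n) (l : 'I_N) :
  injective g -> (forall i, g i != l) ->
  exists F, [/\ path_cover F, [::] \notin F &
    [set ij | [set g ij.1; g ij.2] \in cycle_edges] = graph F].
Proof.
move=> gI gl; pose c := traject cycle_next l N.
have [F0 [F1 F2 F3]] := runs_exist (fun y => y \in codom g) c.
(* A left inverse of [g]; the default [i0] is taken only outside the image. *)
pose gi y := odflt i0 [pick i | g i == y].
have giK : cancel g gi.
  by move=> i; rewrite /gi; case: pickP => [j /eqP/gI //|/(_ i)]; rewrite eqxx.
have gK y : y \in codom g -> g (gi y) = y by case/codomP=> i ->; rewrite giK.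
have fF : flatten (map (map gi) F0) = map gi [seq y <- c | y \in codom g].
  by rewrite -F1 map_flatten.
have steps_map p : steps (map gi p) = [seq (gi xy.1, gi xy.2) | xy <- steps p].
  by elim: p => [|a [|b p] IH] //; rewrite /= in IH *; rewrite -IH.
have fS : flatten (map (@steps _) (map (map gi) F0)) =
    [seq (gi xy.1, gi xy.2) | xy <- steps c & (xy.1 \in codom g) && (xy.2 \in codom g)].
  by rewrite -F3 map_flatten -!map_comp; congr flatten; apply: eq_map => p /=.
have memS i j : ((i, j) \in flatten (map (@steps _) (map (map gi) F0))) = (cycle_next (g i) == g j).
  rewrite fS; apply/mapP/eqP => [[[a b]]|ij].
    rewrite mem_filter /= => /andP[/andP[ag bg] ab] [-> ->].
    by rewrite !gK // (steps_next ab).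
  exists (g i, g j); last by rewrite /= !giK.
  rewrite mem_filter /= !codom_f /= -ij; apply: cycle_next_mem.
  by rewrite ij.
exists (map (map gi) F0); split.
- split=> [|i]; rewrite fF.
    rewrite map_inj_in_uniq ?filter_uniq ?cycle_uniq // => a b.
    by rewrite !mem_filter => /andP[ag _] /andP[bg _] /(congr1 g); rewrite !gK.
  by apply/mapP; exists (g i); rewrite ?giK // mem_filter codom_f mem_cycle.
- by apply/mapP => -[p pF pE]; case: p pF pE => // pF; rewrite pF in F2.
by apply/setP => -[i j]; rewrite !inE !memS cycle_edgesP.
Qed.

End Cycles.

(** * A monotone bipartite graph is determined by its degrees *)

(** Having used [j'] in row [i], [r'] can no longer reach the smaller column [j] in later rows.
    Earlier rows agree, so column [j] has smaller degree in [r'] than in [r]. *)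
Lemma bipartite_unique_lt n m (r r' : 'I_n -> 'I_m -> bool) (i : 'I_n) (j j' : 'I_m) :
  (forall j, #|[set i | r i j]| = #|[set i | r' i j]|) ->
  (forall (i i' : 'I_n) (j j' : 'I_m), r' i j -> r' i' j' -> i < i' -> j <= j') ->
  (forall i' : 'I_n, i' < i -> r i' =1 r' i') ->
  r i j -> ~~ r' i j -> r' i j' -> j < j' -> False.
Proof.
move=> col mono IH rij nr'ij r'ij' lt_jj'.
suff: #|[set k | r' k j]| < #|[set k | r k j]| by rewrite col ltnn.
apply: proper_card; apply/properP; split; last by exists i; rewrite !inE.
apply/subsetP => k; rewrite !inE => r'kj.
case: (ltngtP k i) => [/IH->//|ik|/val_inj ki]; last by rewrite ki.
by have := mono _ _ _ _ r'ij' r'kj ik; rewrite leqNgt lt_jj'.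
Qed.

(** At the first row where they differ, equal row degrees give each relation a column that the other
    lacks. The relation owning the smaller of these columns plays [r] in [bipartite_unique_lt]. *)
Lemma bipartite_unique n m (r r' : 'I_n -> 'I_m -> bool) :
  (forall i, #|[set j | r i j]| = #|[set j | r' i j]|) ->
  (forall j, #|[set i | r i j]| = #|[set i | r' i j]|) ->
  (forall (i i' : 'I_n) (j j' : 'I_m), r i j -> r i' j' -> i < i' -> j <= j') ->
  (forall (i i' : 'I_n) (j j' : 'I_m), r' i j -> r' i' j' -> i < i' -> j <= j') ->
  forall i, r i =1 r' i.
Proof.
move=> row col mono mono' i.
have [k] := ubnP (nat_of_ord i); elim: k i => // k IHk i; rewrite ltnS => le_ik.
have IH (i' : 'I_n) : i' < i -> r i' =1 r' i' by move=> i'i; apply: IHk; exact: leq_trans le_ik.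
have IH' (i' : 'I_n) : i' < i -> r' i' =1 r i' by move=> i'i j; rewrite IH.
have sub : [set j | r i j] \subset [set j | r' i j].
  apply/subsetP => j; rewrite !inE => rij; apply/negPn/negP => nr'ij.
  have : ~~ ([set j | r' i j] \subset [set j | r i j]).
    apply/negP => sub; have := nr'ij; suff -> : r' i j = r i j by rewrite rij.
    have /eqP/setP/(_ j) : [set j | r' i j] == [set j | r i j] by rewrite eqEcard sub row leqnn.
    by rewrite !inE.
  case/subsetPn => j'; rewrite !inE => r'ij' nrij'.
  case: (ltngtP j j') => [jj'|j'j|/val_inj jj'].
  - exact: (bipartite_unique_lt col mono' IH rij nr'ij r'ij' jj').
  - exact: (bipartite_unique_lt (fun j => esym (col j)) mono IH' r'ij' nrij' rij j'j).
  by case/negP: nr'ij; rewrite jj'.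
have /eqP/setP E : [set j | r i j] == [set j | r' i j] by rewrite eqEcard sub row leqnn.
by move=> j; have := E j; rewrite !inE.
Qed.

Local Open Scope ring_scope.

(** * Crossings in a double chain *)

Section Geometry.
Variable R : realType.
Implicit Types (p q r s : (R * R)%type).

Lemma orient_rot p q r : orient q r p = orient p q r.
Proof. by rewrite /orient; ring. Qed.

Lemma orient_swap p q r : orient p r q = - orient p q r.
Proof. by rewrite /orient; ring. Qed.

Lemma ratio_range (a b : R) : a * b < 0 -> 0 <= a / (a - b) <= 1.
Proof.
move=> ab; have [a0|a0|a0] := ltgtP a 0; last by rewrite a0 mul0r ltxx in ab.
  have b0 : 0 < b by rewrite -(nmulr_rlt0 _ a0).
  have d0 : a - b < 0 by lra.
  by rewrite ler_ndivlMr // ler_ndivrMr // mul0r mul1r; lra.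
have b0 : b < 0 by rewrite -(pmulr_rlt0 _ a0).
have d0 : 0 < a - b by lra.
by rewrite ler_pdivlMr // ler_pdivrMr // mul0r mul1r; lra.
Qed.

Lemma segments_meet p q r s :
  orient p q r * orient p q s < 0 -> orient r s p * orient r s q < 0 ->
  exists x, on_seg p q x /\ on_seg r s x.
Proof.
move=> h1 h2; set a := orient r s p in h2 *; set b := orient r s q in h2.
set c := orient p q r in h1 *; set d := orient p q s in h1.
have ab : a - b != 0.
  apply: contraTneq h2 => /eqP; rewrite subr_eq0 => /eqP->; by rewrite -leNgt -expr2 sqr_ge0.
(* Up to sign, both differences are the determinant of the two directions, so Cramer's rule gives
   both parameters the same denominator. *)
have cd : c - d = - (a - b) by rewrite /a /b /c /d /orient; ring.
have cd0 : c - d != 0 by rewrite cd oppr_eq0.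
exists (p.1 + a / (a - b) * (q.1 - p.1), p.2 + a / (a - b) * (q.2 - p.2)).
split; [exists (a / (a - b)) | exists (c / (c - d))]; split; rewrite ?ratio_range //=.
rewrite cd invrN mulrN; split; apply: (mulfI ab).
  have -> : (a - b) * (p.1 + a / (a - b) * (q.1 - p.1)) = (a - b) * p.1 + a * (q.1 - p.1) by field.
  have -> : (a - b) * (r.1 + - (c / (a - b)) * (s.1 - r.1)) = (a - b) * r.1 - c * (s.1 - r.1) by field.
  by rewrite /a /b /c /orient; ring.
have -> : (a - b) * (p.2 + a / (a - b) * (q.2 - p.2)) = (a - b) * p.2 + a * (q.2 - p.2) by field.
have -> : (a - b) * (r.2 + - (c / (a - b)) * (s.2 - r.2)) = (a - b) * r.2 - c * (s.2 - r.2) by field.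
by rewrite /a /b /c /orient; ring.
Qed.

Section Crossing.
Variables (N : nat) (P : 'I_N -> (R * R)%type) (E : {set {set 'I_N}}).
Hypothesis polyE : is_polygonization P E.

Lemma polygon_no_crossing (a b c d : 'I_N) :
  [set a; b] \in E -> [set c; d] \in E -> a != c -> a != d -> b != c -> b != d ->
  orient (P a) (P b) (P c) * orient (P a) (P b) (P d) < 0 ->
  orient (P c) (P d) (P a) * orient (P c) (P d) (P b) < 0 -> False.
Proof.
move=> abE cdE ac ad bc bd h1 h2; have [x [x1 x2]] := segments_meet h1 h2.
have ne : [set a; b] != [set c; d] by rewrite set2_eq (negPf ac) (negPf ad).
have [||v] := polyE.2 _ _ abE cdE ne x; [by exists a, b | by exists c, d|].
rewrite !inE => /andP[/orP[]/eqP->]; first by rewrite (negPf ac) (negPf ad).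
by rewrite (negPf bc) (negPf bd).
Qed.

(* The sign plays no role here.  It only matters for crossings of an edge inside
   a chain with an edge joining the two chains, and these are never used. *)
Lemma chain_no_crossing (A : {set 'I_N}) (sg : R) (a b c d : 'I_N) :
  sg = 1 \/ sg = -1 -> convex_chain P A sg ->
  a \in A -> b \in A -> c \in A -> d \in A ->
  (P a).1 < (P b).1 -> (P b).1 < (P c).1 -> (P c).1 < (P d).1 ->
  [set a; c] \in E -> [set b; d] \in E -> False.
Proof.
move=> sgE [_ cvx] aA bA cA dA ab bc cd acE bdE.
have ne x y : (P x).1 < (P y).1 -> x != y by apply: contraTneq => ->; rewrite ltxx.
(* All four increasing triples turn the same way, so each of the segments [ac] and [bd] separates
   the endpoints of the other. *)
have ac := lt_trans ab bc; have bd := lt_trans bc cd.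
have o1 := cvx _ _ _ aA bA cA ab bc; have o2 := cvx _ _ _ aA cA dA ac cd.
have o3 := cvx _ _ _ aA bA dA ab bd; have o4 := cvx _ _ _ bA cA dA bc cd.
have neg (x y : R) : 0 < sg * x -> 0 < sg * y -> - x * y < 0.
  by case: sgE => ->; rewrite ?mul1r ?mulN1r => x0 y0; nra.
apply: (polygon_no_crossing acE bdE (ne _ _ ab) (ne _ _ (lt_trans ac cd)) _ (ne _ _ cd)).
- by rewrite eq_sym ne.
- by rewrite orient_swap neg.
by rewrite orient_rot [orient (P b) (P d) (P c)]orient_swap mulrN -mulNr neg.
Qed.

(** The four orientations put [u1], [u2], [l1], [l2] in convex position in this cyclic order, so the
    two edges would be the diagonals of a convex quadrilateral. *)
Lemma spanning_no_crossing (U : {set 'I_N}) (u1 u2 l1 l2 : 'I_N) :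
  (forall u1 u2 l, u1 \in U -> u2 \in U -> l \notin U ->
     (P u1).1 < (P u2).1 -> orient (P u1) (P u2) (P l) < 0) ->
  (forall l1 l2 u, l1 \notin U -> l2 \notin U -> u \in U ->
     (P l1).1 < (P l2).1 -> 0 < orient (P l1) (P l2) (P u)) ->
  u1 \in U -> u2 \in U -> l1 \notin U -> l2 \notin U ->
  (P u1).1 < (P u2).1 -> (P l2).1 < (P l1).1 ->
  [set u1; l1] \in E -> [set u2; l2] \in E -> False.
Proof.
move=> below above u1U u2U l1U l2U u12 l21 e1 e2.
have ne (x y : 'I_N) : (P x).1 < (P y).1 -> x != y by apply: contraTneq => ->; rewrite ltxx.
have neU u l : u \in U -> l \notin U -> u != l by move=> uU; apply: contraNneq => <-.
have o1 := below _ _ _ u1U u2U l1U u12; have o2 := below _ _ _ u1U u2U l2U u12.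
have o3 := above _ _ _ l2U l1U u1U l21; have o4 := above _ _ _ l2U l1U u2U l21.
apply: (polygon_no_crossing e1 e2 (ne _ _ u12) (neU _ _ u1U l2U)).
- by rewrite eq_sym neU.
- by rewrite eq_sym ne.
- have -> : orient (P u1) (P l1) (P l2) = - orient (P l2) (P l1) (P u1) by rewrite /orient; ring.
  by rewrite orient_swap mulrNN nmulr_rlt0.
have -> : orient (P u2) (P l2) (P l1) = orient (P l2) (P l1) (P u2) by rewrite /orient; ring.
by rewrite orient_rot nmulr_rlt0.
Qed.

End Crossing.
End Geometry.

(** * From polygonizations to pairs of forests *)

Lemma sorted_enum (R : realType) (T : finType) (A : {set T}) (k : T -> R) (n : nat) :
  #|A| = n -> {in A &, injective k} ->
  exists g : 'I_n -> T, [/\ injective g, forall i, g i \in A,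
    forall y, y \in A -> exists i, y = g i & forall i j : 'I_n, (i < j)%N -> k (g i) < k (g j)].
Proof.
move=> cA kI; pose s := sort (relpre k <=%R) (enum A).
have ms y : (y \in s) = (y \in A) by rewrite mem_sort mem_enum.
have us : uniq s by rewrite sort_uniq enum_uniq.
have sz : size s == n by rewrite size_sort -cardE cA.
have gP i : tnth (Tuple sz) i \in A by rewrite -ms mem_tnth.
have gI : injective (tnth (Tuple sz)) by apply/tuple_uniqP.
exists (tnth (Tuple sz)); split=> // [y|i j ij].
  by rewrite -ms => /(tnthP (Tuple sz)).
rewrite lt_neqAle; apply/andP; split.
  apply: contraTneq ij => /(kI _ _ (gP i) (gP j))/gI->; by rewrite ltnn.
have x0 := tnth (Tuple sz) i.
rewrite !(tnth_nth x0) /=.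
have tot : total (relpre k <=%R) by move=> x y; exact: le_total.
have tr : transitive (relpre k <=%R) by move=> y x z; exact: le_trans.
by apply: (sorted_ltn_nth tr x0 (sort_sorted tot _)); rewrite // inE (eqP sz).
Qed.

Lemma card_preim_in (T : finType) n (g : 'I_n -> T) (A B : {set T}) :
  injective g -> (forall i, g i \in A) -> (forall y, y \in A -> exists i, y = g i) ->
  #|[set i | g i \in B]| = #|B :&: A|.
Proof.
move=> gI gA gS; rewrite -(card_imset _ gI); apply: eq_card => y.
rewrite inE; apply/imsetP/andP => [[i]|[yB /gS[i yi]]]; first by rewrite inE => ? ->.
by exists i; rewrite // inE -yi.
Qed.


(** Edges are recorded by their labels along a chain, so both chains give forests on the same
    ['I_n]. *)
Definition trace (T : finType) n (g : 'I_n -> T) (E : {set {set T}}) : {set 'I_n * 'I_n} :=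
  [set ij | [set g ij.1; g ij.2] \in E].

Section Bound.
Variables (R : realType) (n : nat) (P : 'I_(2 * n) -> (R * R)%type) (U : {set 'I_(2 * n)}).

Lemma trace_forest (A : {set 'I_(2 * n)}) (sg : R) (g : 'I_n -> 'I_(2 * n)) E l :
  is_polygonization P E -> sg = 1 \/ sg = -1 -> convex_chain P A sg ->
  injective g -> (forall i, g i \in A) ->
  (forall i j : 'I_n, (i < j)%N -> (P (g i)).1 < (P (g j)).1) ->
  l \notin A -> trace g E \in forests n.
Proof.
move=> pE sgE cA gI gA gm lA; rewrite inE; apply/asboolP; split.
  move=> x y z t; rewrite !inE /= => xz yt /andP[xy yz] zt.
  exact: (chain_no_crossing pE sgE cA (gA x) (gA y) (gA z) (gA t)
    (gm _ _ xy) (gm _ _ yz) (gm _ _ zt) xz yt).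
have [[s Es] _] := pE.
have [n0|n0] := posnP n.
  by have := ltn_ord l; rewrite {2}n0.
have gl i : g i != l by apply: contraNneq lA => <-.
by rewrite /trace Es; exact: (cycle_forest s (Ordinal n0) gI gl).
Qed.

Lemma card_polygonizations_le :
  (1 < n)%N -> is_double_chain P U -> (#|polygonizations P| <= #|forests n| ^ 2)%N.
Proof.
move=> n1 [PI [cU [[sg [sgE [cvU cvL]]] [below above]]]].
have cL : #|~: U| = n by rewrite cardsCs setCK card_ord cU mul2n -addnn addnK.
have sgE' : - sg = 1 \/ - sg = -1 by case: sgE => ->; rewrite ?opprK; auto.
have [g [gI gU gS gm]] := sorted_enum cU cvU.1.
have [h [hI hL hS hm]] := sorted_enum cL cvL.1.
have hN i : h i \notin U by rewrite -in_setC.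
have [u uU] : exists u, u \in U by apply/card_gt0P; rewrite cU ltnW.
have [l lL] : exists l, l \in ~: U by apply/card_gt0P; rewrite cL ltnW.
pose f E := (trace g E, trace h E).
have fI : {in polygonizations P &, injective f}.
  have sub E E' : E \in polygonizations P -> E' \in polygonizations P -> f E = f E' -> E \subset E'.
    rewrite !inE => /asboolP pE /asboolP pE' [/setP eg /setP eh].
    have [[s Es] _] := pE; have [[s' Es'] _] := pE'.
    (* This is where [1 < n] matters: in a cycle on two points the vertices have a single
       neighbour. *)
    have N2 : (2 < 2 * n)%N by lia.
    have deg x : #|[set y | [set x; y] \in E]| = #|[set y | [set x; y] \in E']|.
      by rewrite Es Es' !cycle_degree.
    (* All degrees being two, the number of neighbours in one chain determines the number in the
       other. *)
    have degI (B : {set 'I_(2 * n)}) x :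
        #|[set y | [set x; y] \in E] :&: B| = #|[set y | [set x; y] \in E'] :&: B| ->
        #|[set y | [set x; y] \in E] :&: ~: B| = #|[set y | [set x; y] \in E'] :&: ~: B|.
      move=> eB; have := deg x; rewrite -(cardsID B) -[in RHS](cardsID B) eB !setDE.
      by move/eqP; rewrite eqn_add2l => /eqP.
    have nbr (F : {set {set 'I_(2 * n)}}) x m (q : 'I_m -> 'I_(2 * n)) (B : {set 'I_(2 * n)}) :
        injective q -> (forall i, q i \in B) -> (forall y, y \in B -> exists i, y = q i) ->
        #|[set y | [set x; y] \in F] :&: B| = #|[set i | [set x; q i] \in F]|.
      by move=> qI qB qS; rewrite -(card_preim_in _ qI qB qS); apply: eq_card => i; rewrite !inE.
    have mono F : is_polygonization P F -> forall (i i' j j' : 'I_n),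
        [set g i; h j] \in F -> [set g i'; h j'] \in F -> (i < i')%N -> (j <= j')%N.
      move=> pF i i' j j' e1 e2 ii'; rewrite leqNgt; apply/negP => j'j.
      exact: (spanning_no_crossing pF below above (gU i) (gU i') (hN j) (hN j')
        (gm _ _ ii') (hm _ _ j'j) e1 e2).
    (* The equal traces make the numbers of edges to the other chain agree at every vertex, so
       [bipartite_unique] identifies the edges between the chains. *)
    have cross i j : ([set g i; h j] \in E) = ([set g i; h j] \in E').
      apply: (bipartite_unique (r := fun i j => [set g i; h j] \in E)
                (r' := fun i j => [set g i; h j] \in E')) => [k|k||]; last 2 first.
      - exact: mono.
      - exact: mono.
      - rewrite -!(nbr _ _ _ _ _ hI hL hS); apply: degI; rewrite !(nbr _ _ _ _ _ gI gU gS).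
        by apply: eq_card => m; have := eg (k, m); rewrite !inE.
      have colC (F : {set {set 'I_(2 * n)}}) :
          #|[set m | [set g m; h k] \in F]| = #|[set m | [set h k; g m] \in F]|.
        by apply: eq_card => m; rewrite !inE setUC.
      rewrite !colC -!(nbr _ _ _ _ _ gI gU gS) -(setCK U); apply: degI.
      rewrite !(nbr _ _ _ _ _ hI hL hS).
      by apply: eq_card => m; have := eh (k, m); rewrite !inE.
    apply/subsetP => e eE; have [x [y exy]] : exists x y, e = [set x; y].
      by apply: (@cycle_edges_pair _ s); rewrite -[cycle_edges s]Es.
    move: eE; rewrite {e}exy.
    have pick z : (exists i, z = g i) \/ (exists i, z = h i).
      by have [/gS|] := boolP (z \in U); [left | rewrite -in_setC => /hS; right].
    case: (pick x) => -[i ->]; case: (pick y) => -[j ->].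
    - by have := eg (i, j); rewrite !inE /= => ->.
    - by rewrite cross.
    - by rewrite setUC cross.
    by have := eh (i, j); rewrite !inE /= => ->.
  by move=> E E' pE pE' ff; apply/eqP; rewrite eqEsubset !sub.
rewrite -(card_in_imset fI) expnS expn1 -cardsX; apply: subset_leq_card.
apply/subsetP => _ /imsetP[E + ->]; rewrite inE => /asboolP pE.
rewrite in_setX; apply/andP; split.
  by apply: (trace_forest (l := l) pE sgE cvU gI gU gm); rewrite -in_setC.
by apply: (trace_forest (l := u) pE sgE' cvL hI hL hm); rewrite in_setC uU.
Qed.

End Bound.

(** * The growth constant and the final bound *)

Lemma letter_bound_growth (R : realType) (x : R) :
  x = (28 * 1000 + 398) / (100 * 1000) -> letter_bound x <= growth_const R * x.
Proof.
move=> xE; have k10 : 1000 = 10 ^+ 3 :> R by rewrite -natrX.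
have g1 : 5610 = 561 * 10 :> R by rewrite -natrM.
have -> : growth_const R = ((561 * 10 * 10 ^+ 3 + 718) * 10 ^+ 3 + 614) / 10 ^+ 9.
  by rewrite /growth_const g1 k10 -exprM.
rewrite k10 in xE.
have d0 : 0 < 4 * (1 - 2 * x) ^+ 2 by rewrite xE; lra.
(* The inequality with the denominator of [letter_bound] cleared, which is a comparison of rationals
   at [x = 0.28398], close to the minimizer of [letter_bound x / x]. *)
have : x <= (((561 * 10 * 10 ^+ 3 + 718) * 10 ^+ 3 + 614) / 10 ^+ 9 * x - 1 - 3 / 4 * x) *
    (4 * (1 - 2 * x) ^+ 2).
  by rewrite xE; lra.
rewrite -ler_pdivrMr // /letter_bound => le_x; lra.
Qed.

Theorem theorem3 (R : realType) :
  exists C : R, exists n0 : nat,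
    forall (n : nat), (n0 <= n)%N ->
    forall (P : 'I_(2 * n) -> (R * R)%type) (U : {set 'I_(2 * n)}),
      is_double_chain P U ->
      (#|polygonizations P|%:R : R)
        <= C * (growth_const R ^+ (2 * n)).
Proof.
(* The bound on forests carries no constant factor, so [C = 1]; [n0 = 2] is the condition of
   [card_polygonizations_le]. *)
exists 1, 2%N => n n2 P U /(card_polygonizations_le n2) le_F2.
pose x : R := (28 * 1000 + 398) / (100 * 1000).
have le_g : letter_bound x <= growth_const R * x := letter_bound_growth erefl.
have x_range : 0 < x < 2^-1 by rewrite /x; lra.
have x0 : 0 < x by case/andP: x_range.
have b0 : 0 <= letter_bound x.
  apply: addr_ge0; first by lra.
  by apply: divr_ge0; [exact: ltW | apply: mulr_ge0; rewrite ?sqr_ge0 ?ler0n].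
have g0 : 0 <= growth_const R by rewrite -(pmulr_lge0 _ x0); exact: le_trans le_g.
have le_F : #|forests n|%:R <= growth_const R ^+ n.
  (* Multiplying by [x ^+ n] reduces the claim to the [n]-th power of [le_g]. *)
  rewrite -(ler_pM2r (exprn_gt0 n x0)) -exprMn; apply: le_trans (forests_count x_range n) _.
  by rewrite lerXn2r ?nnegrE // mulr_ge0 ?(ltW x0).
rewrite mul1r [leRHS](_ : _ = (growth_const R ^+ n) ^+ 2); last by rewrite -exprM mulnC.
apply: (@le_trans _ _ (#|forests n| ^ 2)%:R); first by rewrite ler_nat.
by rewrite natrX lerXn2r ?nnegrE ?ler0n ?exprn_ge0.
Qed.
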